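(* Let $P$ be a naturally labeled poset on $[n]=\{1,\dots,n\}$. Then $$L_{\mathcal{E}_P}(m)=\Omega_P^{(\ell)}(m),$$ where $L_{\mathcal{E}_P}$ is the Ehrhart polynomial of the enriched chain polytope $\mathcal{E}_P$ of $P$ and $\Omega_P^{(\ell)}$ is the left enriched order polynomial of $P$.
   Context: A poset $P$ on $[n]$ with order $<_P$ is naturally labeled if $i<_P j$ implies $i<j$ as integers. An antichain of $P$ is a subset of pairwise incomparable elements (the empty set is an antichain). The enriched chain polytope $\mathcal{E}_P\subset\mathbb{R}^n$ is the convex hull of $\{\pm\mathbf{e}_{i_1}\pm\dots\pm\mathbf{e}_{i_k}:\{i_1,\dots,i_k\}\text{ is an antichain of }P\}$ (all sign choices; the empty antichain gives the origin), where $\mathbf{e}_i$ is the $i$-th unit coordinate vector. It is a lattice polytope of dimension $n$. For a lattice polytope $\mathcal{P}\subset\mathbb{R}^n$ and a positive integer $m$, $L_{\mathcal{P}}(m)=|m\mathcal{P}\cap\mathbb{Z}^n|$; this is a polynomial in $m$, called the Ehrhart polynomial. For a positive integer $m$ let $\Omega_m^{(\ell)}=\{0,1,-1,2,-2,\dots,m,-m\}$. For a naturally labeled poset $P$, a left enriched $P$-partition is a map $f:P\to\Omega_m^{(\ell)}$ such that for all $x,y\in P$ with $x<_P y$: (i) $|f(x)|\le|f(y)|$; (ii) $|f(x)|=|f(y)|$ implies $f(y)\ge 0$. $\Omega_P^{(\ell)}(m)$ denotes the number of left enriched $P$-partitions $f:P\to\Omega_m^{(\ell)}$; it is a polynomial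 in $m$, called the left enriched order polynomial of $P$. *)

(* Defs.v *)
From HB Require Import structures.
From mathcomp Require Import all_boot all_order all_algebra finmap.
From mathcomp Require Import boolp classical_sets functions cardinality.
From mathcomp Require Import reals convex.
Set Implicit Arguments.
Unset Strict Implicit.
Unset Printing Implicit Defensive.
Import Order.TTheory GRing.Theory Num.Theory.
Local Open Scope classical_set_scope.
Local Open Scope ring_scope.

(* The ground set [n] = {1, .., n} is 'I_n, i.e., shifted to {0, .., n-1}. *)

Record poset_on (n : nat) := PosetOn {
  ple :> rel 'I_n;
  ple_refl : reflexive ple;
  ple_anti : antisymmetric ple;
  ple_trans : transitive ple }.

Definition plt n (P : poset_on n) : rel 'I_n :=
  fun x y => (x != y) && P x y.

Definition naturally_labeled n (P : poset_on n) : Prop :=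
  forall i j : 'I_n, plt P i j -> (i < j)%N.

Definition antichain n (P : poset_on n) (A : {set 'I_n}) : Prop :=
  forall x y, x \in A -> y \in A -> x != y -> ~~ P x y /\ ~~ P y x.

Section Ehrhart.
Variables (R : realType) (n : nat).

Definition convex_hull (V : set 'rV[R]_n) : set 'rV[R]_n :=
  smallest (@convex_set R 'rV[R]_n) V.

Definition integer_lattice : set 'rV[R]_n :=
  [set v | forall i, v ord0 i \is a Num.int].

Definition lattice_points (A : set 'rV[R]_n) (m : nat) : set 'rV[R]_n :=
  [set m%:R *: v | v in A] `&` integer_lattice.

(* fset_set maps infinite sets to fset0, so this is the number of lattice
   points of m A as soon as A is bounded, e.g., when A is a polytope. *)
Definition ehrhart (A : set 'rV[R]_n) (m : nat) : nat :=
  #|` fset_set (lattice_points A m) |%fset.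

(* The sign of e_i is (-1) ^+ s i. *)
Definition enriched_chain_polytope (P : poset_on n) : set 'rV[R]_n :=
  convex_hull
    [set v | exists (A : {set 'I_n}) (s : 'I_n -> bool),
       antichain P A /\
       v = \sum_(i in A) (-1) ^+ s i *: delta_mx ord0 i].

End Ehrhart.

Arguments enriched_chain_polytope R [n] P _.

Definition Omega_seq (m : nat) : seq int :=
  [seq k%:Z | k <- iota 0 m.+1] ++ [seq - k%:Z | k <- iota 1 m].

Definition Omega (m : nat) : finType := seq_sub (Omega_seq m).

Definition left_enriched n (P : poset_on n) m (f : {ffun 'I_n -> Omega m}) :
    bool :=
  [forall x, forall y, plt P x y ==>
     (`|val (f x)| <= `|val (f y)|) &&
     ((`|val (f x)| == `|val (f y)|) ==> (0 <= val (f y)))].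

Definition left_enriched_order n (P : poset_on n) (m : nat) : nat :=
  #|[set f : {ffun 'I_n -> Omega m} | left_enriched P f]%SET|.

(* Main.v *)
Require Import Defs.
From mathcomp Require Import all_boot all_order all_algebra reals.
From mathcomp Require Import finmap zify lra.
From mathcomp Require Import boolp classical_sets cardinality convex.
From mathcomp Require Import interval_inference unstable.
Set Implicit Arguments.
Unset Strict Implicit.
Unset Printing Implicit Defensive.
Import Order.TTheory GRing.Theory Num.Theory.
Local Open Scope ring_scope.

(** Both sides count the integer maps a such that every chain C satisfies
    sum_(x in C) |a x| <= m. Let h x be the largest value of this sum over the
    chains with top x, so that h x = |a x| + max_(y < x) h y.

    For lattice points: every vertex satisfies the chain inequalities with
    m = 1; conversely, if h <= m, then a is the sum over t < m of the signed
    indicator vectors of { x | h x - |a x| <= t < h x }, which are antichains,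
    so a / m is a mean of vertices.

    For left enriched P-partitions: f |-> a with
    a x = sgn (f x) (|f x| - max_(y < x) |f y|) is a bijection, because
    |f| = h, and f x >= 0 is forced wherever a x = 0. *)

(** * Heights of weighted chains *)

Section Height.
Variables (n : nat) (P : poset_on n).

Fixpoint height_upto (w : 'I_n -> nat) (k : nat) (x : 'I_n) : nat :=
  if k is k'.+1 then (w x + \max_(y | plt P y x) height_upto w k' y)%N else 0%N.

(* The largest weight of a chain with top x: n iterations suffice, since a chain
   has at most n elements. *)
Definition height w x := height_upto w n x.

(** Bounds heights by checking single elements and comparable pairs only; [h] is not restricted to
    naturals, so that it can be a scaled real potential. *)
Lemma height_upto_le (R : numDomainType) (w : 'I_n -> nat) (h : 'I_n -> R) :
  (forall x, (w x)%:R <= h x) ->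
  (forall x y, plt P y x -> h y + (w x)%:R <= h x) ->
  forall k x, (height_upto w k x)%:R <= h x.
Proof.
move=> h1 h2; elim=> [|k IH] x /=; first exact: le_trans (h1 x).
elim/big_ind: _ => [|i j hi hj|y yx]; first by rewrite addn0.
  by rewrite /maxn; case: ifP.
by rewrite natrD addrC; apply: le_trans (h2 _ _ yx); rewrite lerD2r.
Qed.

Hypothesis P_nat : naturally_labeled P.

(** Labels strictly decrease down a chain, so the recursion from [x] has ended after [x + 1]
    levels. *)
Lemma height_uptoS w k (x : 'I_n) : (x < k)%N -> height_upto w k.+1 x = height_upto w k x.
Proof.
elim: k x => [|k IH] x //= xk; congr addn; apply: eq_bigr => y /P_nat yx.
by rewrite -IH //; lia.
Qed.

Lemma heightE w x : height w x = (w x + \max_(y | plt P y x) height w y)%N.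
Proof. by rewrite /height -height_uptoS. Qed.

Lemma height_unique w (h : 'I_n -> nat) :
  (forall x, h x = (w x + \max_(y | plt P y x) h y)%N) -> h =1 height w.
Proof.
move=> hE; suff H k (x : 'I_n) : (x < k)%N -> h x = height_upto w k x by move=> x; apply: H.
elim: k x => [|k IH] x //= xk; rewrite hE; congr addn; apply: eq_bigr => y /P_nat yx.
by apply: IH; lia.
Qed.

Lemma leq_height w x y : plt P y x -> (height w y + w x <= height w x)%N.
Proof.
move=> yx; rewrite (heightE w x) addnC leq_add2l.
exact: (@leq_bigmax_cond _ (fun y => plt P y x) (height w)).
Qed.

End Height.

(** * The bijection between left enriched maps and integer vectors *)

Section Transfer.
Variables (n : nat) (P : poset_on n).
Implicit Types a f : 'I_n -> int.

Definition left_enriched_map f := forall x y, plt P x y ->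
  (`|f x| <= `|f y|)%N /\ (`|f x|%N = `|f y|%N -> 0 <= f y).

(** The subtraction is truncated, but exact on left enriched maps. *)
Definition to_lattice f x : int :=
  Num.sg (f x) * (`|f x| - \max_(y | plt P y x) `|f y|)%N%:Z.

Definition of_lattice a x : int :=
  let h := (height P (fun y => `|a y|%N) x)%:Z in if a x < 0 then - h else h.

Lemma maxn_left_enriched f x : left_enriched_map f ->
  (\max_(y | plt P y x) `|f y| <= `|f x|)%N /\
  ((\max_(y | plt P y x) `|f y|)%N = `|f x|%N -> 0 <= f x).
Proof.
move=> lf; split; first by apply/bigmax_leqP => y /lf [].
have [/= y yx|no] := pickP (fun y => plt P y x).
  by have [z zx ->] := @eq_bigmax_cond _ (fun y => plt P y x)
       (fun y => `|f y|%N) ltac:(by apply/card_gt0P; exists y); apply lf.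
(* Without predecessors the maximum is 0, so equality means [f x = 0]. *)
by rewrite big_pred0 //; lia.
Qed.

Hypothesis P_nat : naturally_labeled P.

Lemma height_to_lattice f : left_enriched_map f ->
  (fun x => `|f x|%N) =1 height P (fun y => `|to_lattice f y|%N).
Proof.
move=> lf; apply: height_unique => // x; rewrite /to_lattice.
have [] := maxn_left_enriched x lf; set M := \max_(y | _) _ => M1 M2.
by rewrite abszM; case: (sgrP (f x)) => /=; lia.
Qed.

(** The sign of [f x] is lost only where [|f x|] equals the maximum below [x]; there [f x] is
    nonnegative, which is the sign that [of_lattice] restores. *)
Lemma to_latticeK f : left_enriched_map f -> of_lattice (to_lattice f) =1 f.
Proof.
move=> lf x; rewrite /of_lattice -(height_to_lattice lf) /to_lattice.
have [] := maxn_left_enriched x lf; set M := \max_(y | _) _ => M1 M2.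
by case: ifP; case: (sgrP (f x)); lia.
Qed.

Lemma absz_of_lattice a x :
  `|of_lattice a x|%N = height P (fun y => `|a y|%N) x.
Proof. by rewrite /of_lattice; case: ifP; lia. Qed.

(** If [x] lies below [y] and their heights agree, then [a y = 0], and [of_lattice] takes its
    nonnegative branch at [y]. *)
Lemma of_lattice_left_enriched a : left_enriched_map (of_lattice a).
Proof.
move=> x y /(leq_height P_nat (fun y => `|a y|%N)); rewrite !absz_of_lattice.
by rewrite /of_lattice; case: ifP; lia.
Qed.

Lemma of_latticeK a : to_lattice (of_lattice a) =1 a.
Proof.
move=> x; rewrite /to_lattice; under eq_bigr do rewrite absz_of_lattice.
rewrite absz_of_lattice /of_lattice (heightE P_nat _ x); set M := \max_(y | _) _.
by rewrite addnK; case: ifP => a0; case: sgrP; lia.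
Qed.

End Transfer.

Lemma sum_nat_itv (lo hi m : nat) : (hi <= m)%N ->
  (\sum_(t < m) (lo <= t < hi) = hi - lo)%N.
Proof.
(* With [minn m hi] the claim holds for every [m], which makes induction possible. *)
move=> him; suff -> : (\sum_(t < m) (lo <= t < hi) = minn m hi - lo)%N by lia.
by elim: m {him} => [|m IH]; rewrite ?big_ord0 ?big_ord_recr /= ?IH; lia.
Qed.

Lemma signed_indicatorE (R : pzRingType) n (A : {set 'I_n}) (s : 'I_n -> bool) x :
  (\sum_(i in A) (-1) ^+ s i *: delta_mx ord0 i : 'rV[R]_n) ord0 x =
  (x \in A)%:R * (-1) ^+ s x.
Proof.
rewrite summxE big_mkcond (bigD1 x) //= big1 => [|i ix]; last first.
  by case: ifP => // _; rewrite !mxE eq_sym (negPf ix) andbF mulr0.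
by case: ifP => _; rewrite ?mul0r ?addr0 // !mxE !eqxx mulr1 mul1r.
Qed.

Local Open Scope classical_set_scope.
Local Open Scope convex_scope.

(** The mean of [k + 2] points is the mean of the first [k + 1], with weight [(k + 1) / (k + 2)],
    combined with the last point. *)
Lemma convex_set_mean (R : numFieldType) (M : lmodType R)
    (A : set (convex_lmodType M)) (w : nat -> M) (k : nat) :
  convex_set A -> (forall t, (t <= k)%N -> A (w t)) ->
  A (k.+1%:R^-1 *: \sum_(t < k.+1) w t).
Proof.
move=> cA; elim: k => [|k IH] wA.
  by rewrite big_ord1 invr1 scale1r; apply: wA.
have k0 : 0 <= k.+1%:R / k.+2%:R :> R by rewrite divr_ge0.
have k1 : k.+1%:R / k.+2%:R <= 1 :> R by rewrite ler_pdivrMr ?ltr0Sn// mul1r ler_nat.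
have /= := cA _ _ (Itv01 k0 k1) (mem_set (IH (fun t tk => wA t (leqW tk))))
  (mem_set (wA k.+1 (leqnn _))).
move/set_mem; congr A; rewrite /conv /= [in RHS]big_ord_recr /= [in RHS]scalerDr scalerA.
have -> : k.+1%:R / k.+2%:R / k.+1%:R = k.+2%:R^-1 :> R.
  by rewrite mulrAC mulfV ?mul1r ?pnatr_eq0.
suff -> : (k.+1%:R / k.+2%:R).~ = k.+2%:R^-1 :> R by [].
by rewrite /onem -[X in X - _](@mulfV _ k.+2%:R) ?pnatr_eq0// -mulrBl -natrB ?subSnn ?mul1r.
Qed.

Lemma convex_convex_hull (R : realType) n (V : set 'rV[R]_n) :
  convex_set (convex_hull V : set (convex_lmodType 'rV[R]_n)).
Proof.
move=> u v t /set_mem uV /set_mem vV; apply/mem_set => Q [cQ VQ].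
by apply/set_mem/cQ; apply/mem_set; [apply: uV|apply: vV].
Qed.

(** * Lattice points of the dilated polytope *)

Section Lattice.
Variables (R : realType) (n : nat) (P : poset_on n).
Hypothesis P_nat : naturally_labeled P.

(* h x bounds the weight of every chain with top x; unlike the maximal weight,
   it only has to satisfy linear inequalities, so convexity is immediate. *)
Lemma enriched_chain_polytope_potential (v : 'rV[R]_n) :
  enriched_chain_polytope R P v ->
  exists h : 'I_n -> R, [/\ forall x, `|v ord0 x| <= h x,
    forall x y, plt P y x -> h y + `|v ord0 x| <= h x & forall x, h x <= 1].
Proof.
pose Q : set 'rV[R]_n := [set v | exists h : 'I_n -> R,
  [/\ forall x, `|v ord0 x| <= h x,
      forall x y, plt P y x -> h y + `|v ord0 x| <= h x & forall x, h x <= 1]].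
move=> vP; suff: Q v by []; move: v vP; apply: smallest_sub.
  move=> u v t /set_mem[h [h1 h2 h3]] /set_mem[g [g1 g2 g3]]; apply/mem_set.
  have t0 : 0 <= t%:num by [].
  have t1 : 0 <= t%:num.~ by rewrite subr_ge0.
  have norm_conv x : `|(u <| t |> v : 'rV[R]_n) ord0 x|
      <= t%:num * `|u ord0 x| + t%:num.~ * `|v ord0 x|.
    by rewrite !mxE (le_trans (ler_normD _ _)) // !normrM (ger0_norm t0) (ger0_norm t1).
  exists (fun x => t%:num * h x + t%:num.~ * g x); split=> [x|x y yx|x].
  - apply: le_trans (norm_conv x) _.
    by rewrite lerD // ler_wpM2l.
  - have := norm_conv x.
    have := ler_wpM2l t0 (h2 _ _ yx); have := ler_wpM2l t1 (g2 _ _ yx).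
    rewrite /conv /=; lra.
  - have := ler_wpM2l t0 (h3 x); have := ler_wpM2l t1 (g3 x).
    by rewrite /onem; lra.
move=> _ [A [s [antiA ->]]].
have coef x : `|(\sum_(i in A) (-1) ^+ s i *: delta_mx ord0 i : 'rV[R]_n) ord0 x|
    = (x \in A)%:R.
  by rewrite signed_indicatorE normrM normrX normrN1 expr1n mulr1 ger0_norm.
(* The potential of a vertex is the indicator of the up-set generated by [A]. It jumps at each [x]
   in [A], since no element of the antichain lies strictly below [x]. *)
exists (fun x => [exists y in A, P y x]%:R); split=> [x|x y yx|x].
- rewrite coef ler_nat; case xA: (x \in A) => //.
  by have -> : [exists y in A, P y x] by apply/existsP; exists x; rewrite xA ple_refl.
- rewrite coef -natrD ler_nat; case/andP: yx => yx Pyx.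
  have [/existsP[z /andP[zA Pzy]]|_] := boolP [exists z in A, P z y]; last first.
    case xA: (x \in A) => //.
    by have -> : [exists y in A, P y x] by apply/existsP; exists x; rewrite xA ple_refl.
  have Pzx := ple_trans Pzy Pyx.
  have -> : [exists y in A, P y x] by apply/existsP; exists z; rewrite zA.
  have [xA|//] := boolP (x \in A).
  have zx : z != x.
    by apply: contra_neq yx => zx; apply: (@ple_anti _ P); rewrite Pyx -zx.
  by have [] := antiA _ _ zA xA zx; rewrite Pzx.
- by rewrite lern1 leq_b1.
Qed.

Lemma lattice_pointsP (m : nat) (v : 'rV[R]_n) : (0 < m)%N ->
  lattice_points (enriched_chain_polytope R P) m v <->
  exists2 a : 'I_n -> int, v = \row_x (a x)%:~R &
    forall x, (height P (fun y => `|a y|%N) x <= m)%N.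
Proof.
case: m => // m _; split=> [[[u Pu <-] int_v]|[a -> hm]].
  pose a x := Num.floor ((m.+1%:R *: u) ord0 x).
  have aE x : (a x)%:~R = (m.+1%:R *: u) ord0 x by rewrite /a floorK.
  exists a => [|x]; first by apply/rowP => x; rewrite [RHS]mxE aE.
  have [h [h1 h2 h3]] := enriched_chain_polytope_potential Pu.
  have aN y : `|a y|%:R = m.+1%:R * `|u ord0 y| :> R.
    by rewrite natr_absz intr_norm aE mxE normrM ger0_norm.
  rewrite -(ler_nat R); apply: (@le_trans _ _ (m.+1%:R * h x)); last first.
    by rewrite ler_piMr.
  apply: (height_upto_le (h := fun x => m.+1%:R * h x)) => [y|y z zy].
    by rewrite aN ler_pM2l ?ltr0n.
  by rewrite aN -mulrDr ler_pM2l ?ltr0n ?h2.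
split; last by move=> i; rewrite mxE intr_int.
pose w y := `|a y|%N; pose hgt := height P w.
have w_hgt x : (w x <= hgt x)%N by rewrite /hgt (heightE P_nat) leq_addr.
pose A (t : nat) := [set x | (hgt x - w x <= t < hgt x)%N]%SET.
pose e (t : nat) : 'rV[R]_n := \sum_(x in A t) (-1) ^+ (a x < 0)%R *: delta_mx ord0 x.
exists (m.+1%:R^-1 *: \sum_(t < m.+1) e t).
  apply: convex_set_mean => [|t _]; first exact: convex_convex_hull.
  apply: sub_gen_smallest; exists (A t), (fun x => a x < 0); split=> // x y.
  (* If [x'] were below [y'], then [t < hgt x' <= hgt y' - w y' <= t]. *)
  have antiA x' y' : x' \in A t -> y' \in A t -> x' != y' -> ~~ P x' y'.
    rewrite !inE => xA yA xy; apply/negP => Pxy.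
    have /(leq_height P_nat w) : plt P x' y' by rewrite /plt xy.
    by move: xA yA; rewrite -/hgt; lia.
  by move=> xA yA xy; split; apply: antiA; rewrite // eq_sym.
rewrite scalerA mulfV ?pnatr_eq0 // scale1r; apply/rowP => x; rewrite summxE mxE.
under eq_bigr do rewrite signed_indicatorE inE.
(* As [hgt x <= m.+1], exactly [w x] of the layers [A t] contain [x], all with the sign of [a x]. *)
rewrite -mulr_suml -natr_sum sum_nat_itv ?hm // subKn // /w.
by rewrite natr_absz mulrC mulr_sign -rmorphN; case: ifP => a0; congr (_%:~R); lia.
Qed.

End Lattice.

(** * Finite encoding and the final count *)

Lemma mem_Omega (m : nat) (z : int) : (z \in Omega_seq m) = (`|z| <= m)%N.
Proof.
rewrite /Omega_seq mem_cat; apply/orP/idP => [[]/mapP[k]|zm].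
- by rewrite mem_iota => /andP[_ ?] ->; lia.
- by rewrite mem_iota => /andP[_ ?] ->; lia.
- have [z0|z0] := leP 0 z; [left|right]; apply/mapP; exists `|z|%N;
    by rewrite ?mem_iota; lia.
Qed.

Lemma left_enrichedP n (P : poset_on n) m (f : {ffun 'I_n -> Omega m}) :
  reflect (left_enriched_map P (fun x => val (f x))) (left_enriched P f).
Proof.
apply: (iffP forallP) => [H x y xy|H x].
  have /forallP/(_ y)/implyP/(_ xy) := H x.
  rewrite -!abszE lez_nat => /andP[-> /implyP le0].
  by split=> // E; apply: le0; rewrite E.
apply/forallP => y; apply/implyP => /H[le1 le0] /=.
by rewrite -!abszE lez_nat le1; apply/implyP => /eqP[].
Qed.

Theorem theorem0p2 (R : realType) (n : nat) (P : poset_on n)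
    (P_nat : naturally_labeled P) (m : nat) (m_gt0 : (0 < m)%N) :
  ehrhart (enriched_chain_polytope R P) m = left_enriched_order P m.
Proof.
pose F (f : {ffun 'I_n -> Omega m}) : 'rV[R]_n :=
  \row_x (to_lattice P (fun y => val (f y)) x)%:~R.
pose S := [set f : {ffun 'I_n -> Omega m} | left_enriched P f]%SET.
have F_inj : {in S &, injective F}.
  move=> f g; rewrite !inE => /left_enrichedP lf /left_enrichedP lg fg.
  apply/ffunP => x; apply: val_inj.
  rewrite -(to_latticeK P_nat lf) -(to_latticeK P_nat lg).
  congr (of_lattice P _ x); apply: funext => y.
  by move/rowP: fg => /(_ y); rewrite !mxE => /intr_inj.
rewrite /ehrhart /left_enriched_order -/S.
suff -> : lattice_points (enriched_chain_polytope R P) m =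
    [set` [fset F f | f in S]%fset].
  by rewrite set_fsetK card_in_imfset //= cardE.
apply/seteqP; split=> v /=.
  move/(lattice_pointsP P_nat _ m_gt0) => [a -> am].
  (* The height bound for lattice points is exactly the range condition on the preimage. *)
  have bP x : of_lattice P a x \in Omega_seq m by rewrite mem_Omega absz_of_lattice.
  apply/imfsetP; exists [ffun x => SeqSub (bP x)].
    rewrite inE; apply/left_enrichedP.
    have -> : (fun x => val ([ffun x => SeqSub (bP x)] x)) = of_lattice P a.
      by apply: funext => x; rewrite ffunE.
    exact: of_lattice_left_enriched.
  apply/rowP => x; rewrite !mxE -[a x](of_latticeK P_nat); congr (to_lattice P _ x)%:~R.
  by apply: funext => y; rewrite ffunE.
move=> /imfsetP[f]; rewrite inE => /left_enrichedP lf ->.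
apply/(lattice_pointsP P_nat _ m_gt0); exists (to_lattice P (fun y => val (f y))) => // x.
by rewrite -(height_to_lattice P_nat lf) -mem_Omega; apply: valP.
Qed.
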